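(* Suppose $(a'\sigma - a\sigma')(x)=0$ for all $x\in\mathbb{R}$. Then for all $n\in\mathbb{N}$, $$\left(\mathbf{E}\,|X_1-\overline{X}^{(n)}_1|^2\right)^{1/2}=0 .$$
   Context: Let $H\in(1/2,1)$ and let $B=(B_t)_{t\in[0,1]}$ be a fractional Brownian motion with Hurst parameter $H$ on a complete probability space $(\Omega,\mathcal{F},P)$, i.e. a continuous centered Gaussian process with covariance $\frac12(s^{2H}+t^{2H}-|t-s|^{2H})$. Let $x_0\in\mathbb{R}$, $a\in C^2(\mathbb{R})$, $\sigma\in C^3(\mathbb{R})$ be real-valued functions with bounded derivatives (up to order 2 and 3 respectively), such that $a$ and $\sigma$ are bounded and $\inf_{x\in\mathbb{R}}\sigma(x)>0$. Let $X=(X_t)_{t\in[0,1]}$ be the unique solution of $X_t = x_0+\int_0^t a(X_\tau)\,d\tau+\int_0^t\sigma(X_\tau)\,dB_\tau$, $t\in[0,1]$, where the integral with respect to $B$ is a pathwise Riemann–Stieltjes integral. For $n\in\mathbb{N}$ put $\overline{X}^{(n)}_1=\mathbf{E}(X_1\mid B_{1/n},B_{2/n},\ldots,B_1)$. *)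

(* Defs.v *)
(* Written against MathComp and MathComp-Analysis. *)
From HB Require Import structures.
From mathcomp Require Import all_boot all_order all_algebra.
From mathcomp Require Import all_classical all_reals all_analysis.
Set Implicit Arguments.
Unset Strict Implicit.
Unset Printing Implicit Defensive.
Import Order.TTheory GRing.Theory Num.Theory.
Import numFieldNormedType.Exports.
Local Open Scope classical_set_scope.
Local Open Scope ring_scope.

Definition Ck (R : realType) (k : nat) (f : R -> R) : Prop :=
  (forall j, (j < k)%N -> forall x, derivable (derive1n j f) x 1) /\
  continuous (derive1n k f).

(* f itself (j = 0) is not required to be bounded. *)
Definition bounded_derivatives (R : realType) (k : nat) (f : R -> R) : Prop :=
  forall j, (0 < j <= k)%N -> bounded_fun (derive1n j f).

(* The sum over the partition a = p_0 < ... < p_m = b, where p = a :: s, with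
   tag xi i chosen in the i-th cell [p_i, p_(i+1)]. *)
Definition RS_sum (R : realType) (f g : R -> R) (a : R) (s : seq R)
    (xi : nat -> R) : R :=
  \sum_(i < size s) f (xi i) * (g (nth 0 s i) - g (nth 0 (a :: s) i)).

(* Pathwise Riemann-Stieltjes integral of f against g over [a, b], as the limit
   of tagged sums when the mesh tends to 0. *)
Definition is_RS_integral (R : realType) (f g : R -> R) (a b I : R) : Prop :=
  forall e : R, 0 < e -> exists2 delta : R, 0 < delta &
    forall (s : seq R) (xi : nat -> R),
      itv_partition a b s ->
      (forall i, (i < size s)%N ->
        nth 0 s i - nth 0 (a :: s) i < delta /\
        nth 0 (a :: s) i <= xi i <= nth 0 s i) ->
      `|RS_sum f g a s xi - I| < e.

Section Processes.
Context (d : measure_display) (Omega : measurableType d) (R : realType)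
        (P : probability Omega R).

(* s is the standard deviation.  The degenerate case is separate because the
   library's normal_prob m 0 is not the Dirac mass at m. *)
Definition gaussian_law (Y : Omega -> R) : Prop :=
  exists m s : R, forall U : set R, measurable U ->
    pushforward P Y U = if s == 0 then \d_m U else normal_prob m s U.

(* Processes are indexed by R, but only times in [0, 1] are ever considered. *)
Definition gaussian_process (B : R -> Omega -> R) : Prop :=
  forall (k : nat) (t c : 'I_k -> R), (forall i, t i \in `[0, 1]) ->
    gaussian_law (fun w => \sum_(i < k) c i * B (t i) w).

Definition fractional_brownian_motion (H : R) (B : R -> {RV P >-> R}) : Prop :=
  [/\ gaussian_process (fun t => B t),
      forall t, t \in `[0, 1] -> ('E_P[B t] = 0)%E,
      forall s t, s \in `[0, 1] -> t \in `[0, 1] ->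
        covariance P (B s) (B t) =
        (2^-1 * (s `^ (2 * H) + t `^ (2 * H) - `|t - s| `^ (2 * H)))%:E &
      {ae P, forall w, {within `[0, 1], continuous (fun t => B t w)}}].

(* The continuity of paths is the only regularity of X imposed in advance: the
   existence of the Riemann-Stieltjes integrals is part of being a solution. *)
Definition sde_solution (x0 : R) (a sigma : R -> R)
    (B X : R -> {RV P >-> R}) : Prop :=
  {ae P, forall w,
    {within `[0, 1], continuous (fun t => X t w)} /\
    forall t, t \in `[0, 1] ->
      exists2 I : R,
        is_RS_integral (fun tau => sigma (X tau w)) (fun tau => B tau w) 0 t I &
        X t w = x0 + \int[lebesgue_measure]_(tau in `[0, t]) a (X tau w) + I}.

(* The sigma-algebra generated by B_(1/n), B_(2/n), ..., B_1. *)
Definition grid_sigma_algebra (B : R -> {RV P >-> R}) (n : nat) :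
    set (set Omega) :=
  g_sigma_preimage (fun i : 'I_n => (B (i.+1%:R / n%:R) : Omega -> R)).

Definition is_cond_exp (G : set (set Omega)) (Z Y : Omega -> R) : Prop :=
  [/\ forall U : set R, measurable U -> G (Y @^-1` U),
      P.-integrable setT (EFin \o Y) &
      forall A, G A ->
        (\int[P]_(w in A) (Y w)%:E = \int[P]_(w in A) (Z w)%:E)%E].

(* E(Z | G): a chosen version; any two versions are almost surely equal.  For a
   sub-sigma-algebra G and a random variable Z, the junk value cst 0 is used
   only if Z is not integrable, since otherwise a version exists. *)
Definition cond_exp (G : set (set Omega)) (Z : Omega -> R) : Omega -> R :=
  xget (cst 0) [set Y | is_cond_exp G Z Y].

End Processes.

(* Main.v *)
(* Idea. The hypothesis says that (a / sigma)' = 0, so a = c sigma for a constant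
   c. Let F be an antiderivative of 1 / sigma. The chain rule suggests
   F(X_1) = F(x0) + c + B_1 almost surely, which makes X_1 a Borel function of B_1
   alone, hence almost surely equal to its conditional expectation.

   No Hoelder regularity of the paths is needed for the chain rule. Telescope
   F(X_1) - F(X_0) over the uniform partition into n cells and expand each term to
   first order. By the Saks-Henstock lemma, the mere existence of the
   Riemann-Stieltjes integrals of sigma(X) against B makes the absolute errors
   |sigma(X_(t_i)) (B_(t_(i+1)) - B_(t_i)) - int sigma(X) dB|, summed over the
   cells, arbitrarily small. The second-order terms are then controlled by the
   quadratic variation of B over the partition, whose expectation is n^(1 - 2H);
   since H > 1/2 it is almost surely arbitrarily small for arbitrarily large n. *)
Require Import Defs.
From HB Require Import structures.
From mathcomp Require Import all_boot all_order all_algebra.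
From mathcomp Require Import all_classical all_reals all_analysis.
From mathcomp Require Import measurable_realfun.
From mathcomp Require Import ring lra.
Import Order.TTheory GRing.Theory Num.Theory.
Import numFieldNormedType.Exports.
Local Open Scope classical_set_scope.
Local Open Scope ring_scope.

Set Implicit Arguments.
Unset Strict Implicit.

(** * Riemann-Stieltjes sums and the Saks-Henstock lemma *)

(** Tagged partitions of mesh below [delta], remembered only through their sums. Unlike the list and
    the tag function of [RS_sum], they concatenate by a plain induction. *)
Inductive tagged_sum (R : realType) (f g : R -> R) (delta : R) :
    R -> R -> R -> Prop :=
| tagged_sum_nil u : tagged_sum f g delta u u 0
| tagged_sum_cons u v w xi S :
    u < v -> v - u < delta -> u <= xi <= v -> tagged_sum f g delta v w S ->
    tagged_sum f g delta u w (f xi * (g v - g u) + S).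

Section RiemannStieltjes.
Context {R : realType}.
Implicit Types (f g : R -> R) (delta u v w : R).

Lemma tagged_sum_partition f g delta u w S : tagged_sum f g delta u w S ->
  exists s xi, [/\ itv_partition u w s,
    forall i, (i < size s)%N ->
      nth 0 s i - nth 0 (u :: s) i < delta /\
      nth 0 (u :: s) i <= xi i <= nth 0 s i &
    RS_sum f g u s xi = S].
Proof.
elim=> {u w S} [u|u v w t S uv vu ut _ [s [xi [[sv sw] sxi <-]]]].
  exists [::], (fun=> 0); split => //.
  by rewrite /RS_sum /= big_ord0.
exists (v :: s), (fun i => if i is j.+1 then xi j else t); split.
- by split => //=; rewrite uv.
- by case=> [//|i /sxi].
- by rewrite /RS_sum /= big_ord_recl.
Qed.

Lemma RS_integral_tagged_sum f g a b I0 : is_RS_integral f g a b I0 ->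
  forall e, 0 < e -> exists2 delta, 0 < delta &
    forall S, tagged_sum f g delta a b S -> `|S - I0| < e.
Proof.
move=> fgI e /fgI[delta delta0 dI]; exists delta => // S.
by move=> /tagged_sum_partition[s [xi [sab sxi <-]]]; exact: dI.
Qed.

Lemma tagged_sum_cat f g delta u v w S S' :
  tagged_sum f g delta u v S -> tagged_sum f g delta v w S' ->
  tagged_sum f g delta u w (S + S').
Proof.
move=> h; elim: h S' => {u v S} [u S'|u v t xi S uv vu uxi _ IH S' /IH].
  by rewrite add0r.
by move=> ?; rewrite -addrA; exact: (tagged_sum_cons _ _ uxi).
Qed.

Lemma tagged_sum_le f g d d' u v S : d <= d' ->
  tagged_sum f g d u v S -> tagged_sum f g d' u v S.
Proof.
move=> dd'; elim=> {u v S} [u|u v w xi S uv vu uxi _ IH].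
  exact: tagged_sum_nil.
exact: (tagged_sum_cons uv (lt_le_trans vu dd') uxi).
Qed.

Lemma tagged_sum1 f g delta u v xi : u < v -> v - u < delta -> u <= xi <= v ->
  tagged_sum f g delta u v (f xi * (g v - g u)).
Proof.
move=> uv vu uxi; rewrite -[X in tagged_sum _ _ _ _ _ X]addr0.
exact: (tagged_sum_cons uv vu uxi (tagged_sum_nil _ _ _ _)).
Qed.

Lemma tagged_sum_sum f g delta (t S : nat -> R) n :
  (forall i, (i < n)%N -> tagged_sum f g delta (t i) (t i.+1) (S i)) ->
  tagged_sum f g delta (t 0) (t n) (\sum_(i < n) S i).
Proof.
elim: n => [_|n IH tS]; first by rewrite big_ord0; exact: tagged_sum_nil.
rewrite big_ord_recr /=; apply: tagged_sum_cat (tS _ (ltnSn n)).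
by apply: IH => i iltn; apply: tS; rewrite ltnS ltnW.
Qed.

(** Equal cells, tagged at their left ends. *)
Lemma tagged_sum_exists f g delta u v : 0 < delta -> u <= v ->
  exists S, tagged_sum f g delta u v S.
Proof.
move=> delta0 uv.
have [->|u_neq_v] := eqVneq u v; first by exists 0; exact: tagged_sum_nil.
have {u_neq_v} uv' : 0 < v - u by rewrite subr_gt0 lt_neqAle u_neq_v.
pose n := (Num.truncn ((v - u) / delta)).+1.
have n0 : 0 < n%:R :> R by rewrite ltr0n.
pose h := (v - u) / n%:R.
have h0 : 0 < h by rewrite divr_gt0.
have hd : h < delta.
  by rewrite ltr_pdivrMr// mulrC -ltr_pdivrMr// truncnS_gt.
pose t i := u + h * i%:R.
have -> : v = t n by rewrite /t /h divfK ?gt_eqF// subrKC.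
have -> : u = t 0%N by rewrite /t mulr0 addr0.
exists (\sum_(i < n) (f (t i) * (g (t i.+1) - g (t i)))).
have tS i : t i.+1 = t i + h by rewrite /t -natr1 mulrDr mulr1 addrA.
apply: (tagged_sum_sum (S := fun i => f (t i) * (g (t i.+1) - g (t i)))) => i _.
apply: tagged_sum1; rewrite tS.
- by rewrite ltrDl.
- by rewrite addrAC subrr add0r.
- by rewrite lexx lerDl ltW.
Qed.

Section SaksHenstock.
Variables (f g I : R -> R) (b : R).
Hypothesis fgI : forall t, 0 <= t <= b -> is_RS_integral f g 0 t (I t).

(** On a degenerate interval the empty partition satisfies every mesh condition, and its sum is
    0. *)
Lemma RS_integral00 : 0 <= b -> I 0 = 0.
Proof.
move=> b0; apply/eqP/negPn/negP => I0.
have I0_gt0 : 0 < `|I 0| by rewrite normr_gt0.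
have b00 : 0 <= (0 : R) <= b by rewrite lexx.
have [d _ Sd] := RS_integral_tagged_sum (fgI b00) I0_gt0.
by have := Sd 0 (tagged_sum_nil _ _ _ _); rewrite sub0r normrN ltxx.
Qed.

(** Integrals are given from 0 only, so [I v - I u] stands for the integral over [[u, v]]. One fine
    sum over [[0, u]] serves twice, alone (close to [I u]) and as the initial part of a sum over
    [[0, v]] (close to [I v]), and cancels in the difference. *)
Lemma tagged_sum_subinterval u v eta delta : 0 <= u -> u <= v -> v <= b ->
  0 < eta -> 0 < delta ->
  exists2 S, tagged_sum f g delta u v S & `|S - (I v - I u)| < eta.
Proof.
move=> u0 uv vb eta0 delta0.
have eta20 : 0 < eta / 2 by rewrite divr_gt0.
have uI : 0 <= u <= b by rewrite u0 (le_trans uv).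
have vI : 0 <= v <= b by rewrite vb (le_trans u0).
have [d1 d10 Su] := RS_integral_tagged_sum (fgI uI) eta20.
have [d2 d20 Sv] := RS_integral_tagged_sum (fgI vI) eta20.
pose d := Num.min delta (Num.min d1 d2).
have d0 : 0 < d by rewrite !lt_min delta0 d10.
have [S1 S1d] := tagged_sum_exists f g d0 u0.
have [S2 S2d] := tagged_sum_exists f g d0 uv.
exists S2; first by apply: tagged_sum_le S2d; rewrite ge_min lexx.
have dd1 : d <= d1 by rewrite !ge_min lexx orbT.
have dd2 : d <= d2 by rewrite !ge_min lexx !orbT.
have := Su _ (tagged_sum_le dd1 S1d).
have := Sv _ (tagged_sum_cat (tagged_sum_le dd2 S1d) (tagged_sum_le dd2 S2d)).
by rewrite !ltr_norml => /andP[? ?] /andP[? ?]; apply/andP; split; lra.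
Qed.

(** The errors over any subset of the cells add up to at most [2 * e] in absolute value. Applied
    separately to the cells with nonnegative error and to those with negative error, this bounds the
    sum of the absolute errors. *)
Lemma saks_henstock e : 0 <= b -> 0 < e -> exists2 delta, 0 < delta &
  forall (t : nat -> R) n, t 0 = 0 -> t n = b ->
    (forall i, (i < n)%N -> t i < t i.+1 < t i + delta) ->
    \sum_(i < n)
      `|f (t i) * (g (t i.+1) - g (t i)) - (I (t i.+1) - I (t i))| <= 4 * e.
Proof.
move=> b0 e0.
have bI : 0 <= b <= b by rewrite b0 lexx.
have [delta delta0 Sb] := RS_integral_tagged_sum (fgI bI) e0.
exists delta => // t n t0 tn tmesh.
have t_homo i j : (i <= j)%N -> (j <= n)%N -> t i <= t j.
  elim: j => [|j IH]; first by rewrite leqn0 => /eqP ->.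
  rewrite leq_eqVlt => /predU1P[-> //|]; rewrite ltnS => ij jn.
  apply: (le_trans (IH ij (ltnW jn))).
  by have /andP[/ltW] := tmesh _ jn.
pose J i := I (t i.+1) - I (t i).
pose A i := f (t i) * (g (t i.+1) - g (t i)).
have sumJ : \sum_(i < n) J i = I b.
  rewrite -(big_mkord xpredT J) /J telescope_sumr //.
  by rewrite tn t0 RS_integral00 // subr0.
(* At most [n] cells get replaced, so the replacements cost at most [e] in total. *)
pose eta := e / n.+1%:R.
have eta0 : 0 < eta by rewrite divr_gt0.
(* Replacing the cells outside p by fine tagged sums, which nearly equal the
   integrals over these cells, isolates the errors of the cells in p. *)
have subsum_le (p : pred nat) : `|\sum_(i < n | p i) (A i - J i)| <= 2 * e.
  have : forall i, exists S, (i < n)%N ->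
      tagged_sum f g delta (t i) (t i.+1) S /\ `|S - J i| < eta.
    move=> i; case: (ltnP i n) => [iltn|_]; last by exists 0.
    have [|||S] := @tagged_sum_subinterval (t i) (t i.+1) eta delta
      _ _ _ eta0 delta0.
    - by rewrite -t0 t_homo // ltnW.
    - exact: t_homo.
    - by rewrite -tn t_homo.
    - by exists S.
  move=> /choice[S Sapprox].
  pose T i := if p i then A i else S i.
  have Tsum : tagged_sum f g delta 0 b (\sum_(i < n) T i).
    have /= := @tagged_sum_sum f g delta t T n; rewrite t0 tn; apply => i iltn.
    rewrite /T.
    case: ifPn => _; last by have [] := Sapprox _ iltn.
    have /andP[t1 t2] := tmesh _ iltn.
    by apply: tagged_sum1; [|rewrite ltrBlDl|rewrite lexx ltW].
  have -> : \sum_(i < n | p i) (A i - J i) =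
      (\sum_(i < n) T i - I b) - \sum_(i < n | ~~ p i) (S i - J i).
    rewrite -sumJ -sumrB [in RHS](bigID (fun i : 'I_n => p i)) /=.
    rewrite [X in _ = _ + X - _](eq_bigr (fun i : 'I_n => S i - J i)); last first.
      by move=> i /negbTE pi; rewrite /T pi.
    by rewrite addrK; apply: eq_bigr => i pi; rewrite /T pi.
  have Tb := Sb _ Tsum.
  rewrite (le_trans (ler_normB _ _))// mulr2n mulrDl !mul1r lerD ?(ltW Tb)//.
  rewrite (le_trans (ler_norm_sum _ _ _))//.
  apply: (@le_trans _ _ (\sum_(i < n) eta)).
    rewrite [leRHS](bigID (fun i : 'I_n => ~~ p i)) /= -[leLHS]addr0 lerD //.
      by apply: ler_sum => i _; apply: ltW; have [] := Sapprox i (ltn_ord i).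
    by apply: sumr_ge0 => i _; exact: ltW.
  rewrite sumr_const card_ord -mulr_natr /eta mulrAC ler_pdivrMr//.
  by rewrite ler_pM2l// ler_nat.
have := subsum_le (fun i => 0 <= A i - J i).
have := subsum_le (fun i => ~~ (0 <= A i - J i)).
move=> h1 h2; rewrite (bigID (fun i : 'I_n => 0 <= A i - J i)) /=.
suff -> : \sum_(i < n | 0 <= A i - J i) `|A i - J i| =
    `|\sum_(i < n | 0 <= A i - J i) (A i - J i)|.
  suff -> : \sum_(i < n | ~~ (0 <= A i - J i)) `|A i - J i| =
    `|\sum_(i < n | ~~ (0 <= A i - J i)) (A i - J i)| by lra.
  rewrite -normrN -sumrN ger0_norm; last first.
    by apply: sumr_ge0 => i; rewrite -ltNge oppr_ge0 => /ltW.
  by apply: eq_bigr => i; rewrite -ltNge => /ltr0_norm.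
rewrite ger0_norm; last exact: sumr_ge0.
by apply: eq_bigr => i /ger0_norm.
Qed.

End SaksHenstock.

End RiemannStieltjes.

(** * Integrals over segments *)

Section RintegralSegment.
Context {R : realType}.
Notation mu := (@lebesgue_measure R).
Implicit Types (f : R -> R) (a b u v : R).

Lemma within_continuous_integrable f a b : {within `[a, b], continuous f} ->
  mu.-integrable `[a, b] (EFin \o f).
Proof.
by move=> cf; apply: continuous_compact_integrable => //; exact: segment_compact.
Qed.

Lemma Rintegral_segmentB f a b u : {within `[a, b], continuous f} ->
  a <= u <= b ->
  \int[mu]_(x in `[a, b]) f x - \int[mu]_(x in `[a, u]) f x =
  \int[mu]_(x in `[u, b]) f x.
Proof.
move=> cf /andP[au ub]; have intf := within_continuous_integrable cf.
rewrite Rintegral_itvB ?bnd_simp// Rintegral_itv_obnd_cbnd//.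
apply: integrableS intf => //; apply: subset_itvr; by rewrite bnd_simp.
Qed.

Lemma Rintegral_segment_bounds f (m M : R) a b : a <= b ->
  {within `[a, b], continuous f} ->
  (forall x, a <= x <= b -> m <= f x <= M) ->
  m * (b - a) <= \int[mu]_(x in `[a, b]) f x <= M * (b - a).
Proof.
move=> ab cf fmM; have intf := within_continuous_integrable cf.
have intc (r : R) : mu.-integrable `[a, b] (EFin \o cst r).
  apply: within_continuous_integrable; apply: continuous_subspaceT => ?.
  exact: cvg_cst.
have cstE (r : R) : \int[mu]_(x in `[a, b]) r = r * (b - a).
  rewrite Rintegral_cst//= lebesgue_measure_itv/= lte_fin.
  by case: ltgtP ab => [//|//|->] _; rewrite /= subrr.
rewrite -!cstE; apply/andP; split; apply: le_Rintegral; do ?[by []|exact: intc];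
  by move=> x /=; rewrite in_itv/= => /fmM/andP[].
Qed.

Lemma Rintegral_segment_near f (y e : R) a b : a <= b ->
  {within `[a, b], continuous f} ->
  (forall x, a <= x <= b -> `|f x - y| <= e) ->
  `|\int[mu]_(x in `[a, b]) f x - y * (b - a)| <= e * (b - a).
Proof.
move=> ab cf fy.
have fye x : a <= x <= b -> y - e <= f x <= y + e.
  by move=> /fy; rewrite ler_norml => /andP[? ?]; apply/andP; split; lra.
have /andP[? ?] := Rintegral_segment_bounds ab cf fye.
by rewrite ler_norml; apply/andP; split; lra.
Qed.

End RintegralSegment.

(** Heine-Cantor: compactness, in its near-covering form, turns the local moduli of continuity into
    a single one. *)
Lemma segment_uniformly_continuous (R : realType) (f : R -> R) (a b e : R) :
  {within `[a, b], continuous f} -> 0 < e ->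
  exists2 d, 0 < d & forall x y, a <= x <= b -> a <= y <= b ->
    `|x - y| < d -> `|f x - f y| < e.
Proof.
move=> /subspace_continuousP cf e0.
have e20 : 0 < e / 2 by rewrite divr_gt0.
have near_cov : forall x, `[a, b]%classic x ->
    \forall x' \near x & d \near (0 : R)^'+,
      forall y, a <= x' <= b -> a <= y <= b -> `|x' - y| < d ->
        `|f x' - f y| < e.
  move=> x xab; have /cvgrPdist_lt/(_ _ e20) := cf _ xab.
  case=> r /= r0 fr.
  have r20 : 0 < r / 2 by rewrite divr_gt0.
  near=> z d => y /= zab yab zyd.
  have xz : `|x - z| < r / 2 by near: z; exact: nbhsx_ballx.
  have d2 : d < r / 2 by near: d; exact: nbhs_right_lt.
  have fz : `|f x - f z| < e / 2.
    by apply: fr => //=.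
  have fy : `|f x - f y| < e / 2.
    apply: fr => //=.
    rewrite (splitr r) -(subrKA z) (le_lt_trans (ler_normD _ _))// ltrD//.
    exact: lt_trans d2.
  rewrite (splitr e) -(subrKA (f x)) (le_lt_trans (ler_normD _ _))//.
  by rewrite ltrD// distrC.
have /compact_near_coveringP/(_ _ _ _ _ near_cov) := @segment_compact R a b.
move=> [d /= d0 dP]; exists (d / 2); first by rewrite divr_gt0.
move=> x y xab; apply: dP => //=.
- rewrite sub0r normrN gtr0_norm ?divr_gt0//.
  by rewrite ltr_pdivrMr// ltr_pMr// ltr1n.
- by rewrite divr_gt0.
Unshelve. all: by end_near. Qed.

(** * Antiderivatives of continuous functions *)

Section Antiderivative.
Context {R : realType}.
Notation mu := (@lebesgue_measure R).
Variables (f : R -> R).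
Hypothesis f_cont : continuous f.

(* At most one of the two segments is nondegenerate. *)
Definition antiderivative u : R :=
  \int[mu]_(x in `[0, u]) f x - \int[mu]_(x in `[u, 0]) f x.

Lemma antiderivativeB u v : u <= v ->
  antiderivative v - antiderivative u = \int[mu]_(x in `[u, v]) f x.
Proof.
have cf (a b : R) : {within `[a, b], continuous f}.
  exact: continuous_subspaceT.
have int0 (a b : R) : b <= a -> \int[mu]_(x in `[a, b]) f x = 0.
  rewrite le_eqVlt => /predU1P[->|ba]; first by rewrite set_itv1 Rintegral_set1.
  by rewrite set_itv_ge ?Rintegral_set0// bnd_simp -ltNge.
rewrite /antiderivative => uv.
have [u0|/ltW u0] := leP 0 u.
  by rewrite !(int0 _ 0) ?(le_trans u0)// !subr0 Rintegral_segmentB// u0.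
have [v0|/ltW v0] := leP 0 v.
  rewrite (int0 v)// (int0 0 u)// sub0r opprK subr0 addrC.
  by rewrite -(@Rintegral_segmentB _ f u v 0) ?u0// subrKC.
rewrite (int0 0 v)// (int0 0 u)// !sub0r opprK addrC.
by rewrite -(@Rintegral_segmentB _ f u 0 v) ?uv// opprB subrKC.
Qed.

(** The slope bound [M] gives continuity. The slope bound [m] makes the values spread without limit
    in both directions, and the intermediate value theorem concludes. *)
Lemma antiderivative_surjective (m M : R) : 0 < m ->
  (forall x, m <= f x <= M) -> forall y, exists u, antiderivative u = y.
Proof.
move=> m0 fmM y; pose F := antiderivative.
have Fbnd u v : u <= v -> m * (v - u) <= F v - F u <= M * (v - u).
  move=> uv; rewrite /F antiderivativeB//; apply: Rintegral_segment_bounds => //.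
  exact: continuous_subspaceT.
have M0 : 0 < M by have /andP[? ?] := fmM 0; lra.
have cF : continuous F.
  move=> x; apply/cvgrPdist_le => e e0; near=> z.
  have zx : `|x - z| <= e / M.
    by near: z; apply: cvgr_dist_le; [exact: cvg_id|exact: divr_gt0].
  have zxM : M * `|x - z| <= e by rewrite mulrC -ler_pdivlMr.
  apply: le_trans zxM; have [xz|/ltW zx'] := leP x z.
    have /andP[Fz1 Fz2] := Fbnd _ _ xz.
    rewrite distrC (distrC x) !ger0_norm ?subr_ge0//.
    by rewrite -subr_ge0 (le_trans _ Fz1)// mulr_ge0 ?subr_ge0 ?(ltW m0).
  have /andP[Fz1 Fz2] := Fbnd _ _ zx'.
  rewrite !ger0_norm ?subr_ge0//.
  by rewrite -subr_ge0 (le_trans _ Fz1)// mulr_ge0 ?subr_ge0 ?(ltW m0).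
(* Over a length [r], a slope of at least [m] is enough to climb from [F 0] to [y], or to descend to
   it. *)
pose r := `|y - F 0| / m.
have r0 : 0 <= r by rewrite divr_ge0// ltW.
have rm : m * r = `|y - F 0| by rewrite mulrC divfK// gt_eqF.
have [|||c _ <-] := @IVT R F (- r) r y; last by exists c.
- by rewrite lerNl (le_trans _ r0)// oppr_le0.
- exact: continuous_subspaceT.
have /andP[] : F (- r) <= y <= F r.
  have /andP[Fr _] := Fbnd _ _ r0.
  have /Fbnd/andP[Fr' _] : - r <= 0 by rewrite oppr_le0.
  move: Fr Fr'; rewrite sub0r opprK subr0 rm.
  by have := ler_norm (y - F 0); have := ler_norm (- (y - F 0)); rewrite normrN;
    move=> *; apply/andP; split; lra.
by rewrite minC; rewrite ge_min le_max => -> ->; rewrite !orbT.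
Unshelve. all: by end_near. Qed.

End Antiderivative.

(** * The chain rule along a path *)

Section Doss.
Context {R : realType}.
Notation mu := (@lebesgue_measure R).
Variables (sigma : R -> R) (m M K : R).
Hypothesis m_gt0 : 0 < m.
Hypothesis sigma_bounds : forall u, m <= sigma u <= M.
Hypothesis sigma_lipschitz : forall u v, `|sigma u - sigma v| <= K * `|u - v|.

Let sigma_gt0 u : 0 < sigma u.
Proof. by have /andP[+ _] := sigma_bounds u; apply: lt_le_trans. Qed.

Let K_ge0 : 0 <= K.
Proof.
have := sigma_lipschitz 0 1; rewrite sub0r normrN normr1 mulr1.
by apply: le_trans; exact: normr_ge0.
Qed.

Let sigma_continuous : continuous sigma.
Proof.
have K1 : 0 < K + 1 by rewrite ltr_wpDl.
move=> x; apply/cvgrPdist_le => e e0; near=> z.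
rewrite (le_trans (sigma_lipschitz _ _))//.
rewrite (@le_trans _ _ ((K + 1) * `|x - z|)) ?ler_wpM2r ?lerDl//.
rewrite mulrC -ler_pdivlMr//.
by near: z; apply: cvgr_dist_le; [exact: cvg_id|exact: divr_gt0].
Unshelve. all: by end_near. Qed.

Let sigmaV_continuous : continuous (fun u => (sigma u)^-1).
Proof. by move=> x; apply: cvgV; [rewrite gt_eqF|exact: sigma_continuous]. Qed.

(* The Lamperti transform: it turns the equation into one with additive noise. *)
Definition lamperti : R -> R := antiderivative (fun u => (sigma u)^-1).

Let sigmaV_bounds u : M^-1 <= (sigma u)^-1 <= m^-1.
Proof.
have /andP[sm sM] := sigma_bounds u.
by rewrite !lef_pV2 ?posrE// ?sm ?sM// (lt_le_trans _ sM).
Qed.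

Let M_gt0 : 0 < M.
Proof. by have /andP[_] := sigma_bounds 0; apply: lt_le_trans. Qed.

(** The integrand is at least [1 / M]; this is what gives an inverse of at most linear growth. *)
Lemma lamperti_increasing u v : u <= v ->
  (v - u) / M <= lamperti v - lamperti u.
Proof.
move=> uv; rewrite /lamperti antiderivativeB// mulrC.
have cs : {within `[u, v], continuous (fun u => (sigma u)^-1)}.
  exact: continuous_subspaceT.
by have /andP[] := Rintegral_segment_bounds uv cs (fun x _ => sigmaV_bounds x).
Qed.

Lemma lamperti_surjective y : exists u, lamperti u = y.
Proof.
apply: (antiderivative_surjective sigmaV_continuous (m := M^-1) (M := m^-1)) => //.
by rewrite invr_gt0.
Qed.

(** [1 / sigma] is Lipschitz with constant [K / m ^+ 2]. Integrating its deviation from the value at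
    [u] bounds the remainder without any second derivative. *)
Lemma lamperti_taylor u v :
  `|lamperti v - lamperti u - (v - u) / sigma u| <= K / m ^+ 2 * (v - u) ^+ 2.
Proof.
have L0 : 0 <= K / m ^+ 2 by rewrite divr_ge0// exprn_ge0// ltW.
have sV x : `|(sigma x)^-1 - (sigma u)^-1| <= K / m ^+ 2 * `|x - u|.
  have -> : (sigma x)^-1 - (sigma u)^-1 =
      (sigma u - sigma x) * ((sigma x)^-1 * (sigma u)^-1).
    by field; rewrite !gt_eqF.
  rewrite normrM mulrAC ler_pM//; first by rewrite distrC sigma_lipschitz.
  rewrite gtr0_norm ?mulr_gt0 ?invr_gt0// expr2 invfM.
  have /andP[_ xm] := sigmaV_bounds x; have /andP[_ um] := sigmaV_bounds u.
  by rewrite ler_pM// ltW// invr_gt0.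
have cs a b : {within `[a, b], continuous (fun u => (sigma u)^-1)}.
  exact: continuous_subspaceT.
have [uv|/ltW vu] := leP u v.
  rewrite /lamperti antiderivativeB// mulrC expr2 mulrA.
  apply: Rintegral_segment_near => // x /andP[ux xv].
  rewrite (le_trans (sV _))// ler_wpM2l// ger0_norm ?subr_ge0//.
  by rewrite lerB.
have -> : lamperti v - lamperti u - (v - u) / sigma u =
  - ((lamperti u - lamperti v) - (sigma u)^-1 * (u - v)) by ring.
rewrite normrN /lamperti antiderivativeB//.
have -> : K / m ^+ 2 * (v - u) ^+ 2 = (K / m ^+ 2 * (u - v)) * (u - v) by ring.
apply: Rintegral_segment_near => // x /andP[vx xu].
by rewrite (le_trans (sV _))// ler_wpM2l// distrC ger0_norm ?subr_ge0// lerB.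
Qed.

Section Path.
Variables (c x0 : R) (x b J : R -> R).
Hypothesis x_cont : {within `[0, 1], continuous x}.
Hypothesis x_int : forall t, 0 <= t <= 1 ->
  is_RS_integral (fun s => sigma (x s)) b 0 t (J t).
Hypothesis x_eq : forall t, 0 <= t <= 1 ->
  x t = x0 + \int[mu]_(s in `[0, t]) (c * sigma (x s)) + J t.
Hypothesis b_var : forall n0 e, 0 < e -> exists2 n, (n0 <= n)%N &
  \sum_(i < n) (b (i.+1%:R / n%:R) - b (i%:R / n%:R)) ^+ 2 < e.

Let drift_cont (u v : R) : 0 <= u -> v <= 1 ->
  {within `[u, v], continuous (fun s => c * sigma (x s))}.
Proof.
move=> u0 v1; have uv01 : `[u, v]%classic `<=` `[0, 1]%classic.
  by apply: subset_itv; rewrite bnd_simp.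
apply: (continuous_subspaceW uv01).
apply: (@within_continuous_comp _ _ _ _ x (fun u => c * sigma u) _ x_cont) => y _.
by apply: cvgM; [exact: cvg_cst|exact: sigma_continuous].
Qed.

Let x_increment u v : 0 <= u -> u <= v -> v <= 1 ->
  x v - x u = \int[mu]_(s in `[u, v]) (c * sigma (x s)) + (J v - J u).
Proof.
move=> u0 uv v1; rewrite !x_eq ?u0 ?v1 ?(le_trans u0 uv) ?(le_trans uv v1)//.
rewrite -(@Rintegral_segmentB _ _ 0 v u) ?u0 ?uv//; last exact: drift_cont.
by ring.
Qed.

(** The summands come from freezing the drift on each cell, from the Saks-Henstock errors, and from
    the Taylor remainders; 16 bounds the share of the squared Saks-Henstock errors. *)
Let bound := `|c| / m + 4 / m +
  K / m ^+ 2 * (3 * ((`|c| * M) ^+ 2 + M ^+ 2 + 16)).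

(** Here [r] is the Saks-Henstock error of the cell. The increment of [x] is the drift integral plus
    [sigma (x u) * (b v - b u) - r]; dividing it by [sigma (x u)] leaves [c * (v - u) + (b v - b u)]
    up to first-order errors, and the Taylor remainder is quadratic in it. *)
Lemma lamperti_path_cell (u v e r : R) :
  0 <= u -> u < v -> v <= 1 ->
  (forall s, u <= s <= v -> `|sigma (x s) - sigma (x u)| <= e) ->
  r = sigma (x u) * (b v - b u) - (J v - J u) ->
  `|lamperti (x v) - lamperti (x u) - c * (v - u) - (b v - b u)| <=
    `|c| * e / m * (v - u) + `|r| / m + K / m ^+ 2 *
    (3 * ((`|c| * M) ^+ 2 * (v - u) ^+ 2 + M ^+ 2 * (b v - b u) ^+ 2 + `|r| ^+ 2)).
Proof.
move=> u0 uv v1 xe rE.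
pose D := \int[mu]_(s in `[u, v]) (c * sigma (x s)).
have dx : x v - x u = D + sigma (x u) * (b v - b u) - r.
  by rewrite x_increment ?(ltW uv)// -/D rE; ring.
have vu0 : 0 < v - u by rewrite subr_gt0.
have su := sigma_gt0 (x u).
have De : `|D - c * sigma (x u) * (v - u)| <= `|c| * e * (v - u).
  apply: Rintegral_segment_near; [exact: ltW|exact: drift_cont|].
  by move=> s /xe se; rewrite -mulrBr normrM ler_wpM2l.
have DM : `|D| <= `|c| * M * (v - u).
  rewrite -[D]subr0 -(mul0r (v - u)).
  apply: Rintegral_segment_near; [exact: ltW|exact: drift_cont|].
  move=> s _; rewrite subr0 normrM ler_wpM2l// gtr0_norm//.
  by have /andP[] := sigma_bounds (x s).
have -> : lamperti (x v) - lamperti (x u) - c * (v - u) - (b v - b u) =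
  (lamperti (x v) - lamperti (x u) - (x v - x u) / sigma (x u))
  + ((D - c * sigma (x u) * (v - u)) / sigma (x u) - r / sigma (x u)).
  by rewrite dx; field; rewrite gt_eqF.
have Vm y : `|y / sigma (x u)| <= `|y| / m.
  rewrite normrM ler_wpM2l// gtr0_norm ?invr_gt0//.
  by have /andP[] := sigmaV_bounds (x u).
rewrite (le_trans (ler_normD _ _))// addrC lerD//.
  rewrite (le_trans (ler_normB _ _))// lerD// (le_trans (Vm _))//.
  by rewrite [leRHS]mulrAC ler_wpM2r// invr_ge0 ltW.
apply: (le_trans (lamperti_taylor _ _)).
rewrite ler_wpM2l//; first by rewrite divr_ge0// exprn_ge0// ltW.
rewrite dx.
apply: (@le_trans _ _ (3 * (D ^+ 2 + (sigma (x u) * (b v - b u)) ^+ 2 + r ^+ 2))).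
  (* With [z] for the noise term, these three squares add up to exactly the difference between
     [3 * (D ^+ 2 + z ^+ 2 + r ^+ 2)] and [(D + z - r) ^+ 2]. *)
  have := sqr_ge0 (D - sigma (x u) * (b v - b u)).
  have := sqr_ge0 (D + r).
  have := sqr_ge0 (sigma (x u) * (b v - b u) + r).
  by rewrite !expr2; move: (sigma (x u) * (b v - b u)) => z; nra.
rewrite ler_wpM2l// real_normK ?num_real// lerD2r lerD//.
  by rewrite -real_normK ?num_real// -exprMn lerXn2r// nnegrE// !mulr_ge0// ltW.
rewrite exprMn ler_wpM2r ?sqr_ge0// lerXn2r// ?nnegrE ?(ltW su) ?(ltW M_gt0)//.
by have /andP[] := sigma_bounds (x u).
Qed.

(** A single uniform partition serves for everything: its mesh suits uniform continuity and
    Saks-Henstock, and the quadratic variation of [b] along it is below [e]. *)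
Lemma lamperti_path_approx e : 0 < e -> e <= 1 ->
  `|lamperti (x 1) - lamperti (x 0) - c - (b 1 - b 0)| <= bound * e.
Proof.
move=> e0 e1.
have sx_cont : {within `[0, 1], continuous (fun s => sigma (x s))}.
  apply: (@within_continuous_comp _ _ _ _ x sigma _ x_cont) => y _.
  exact: sigma_continuous.
have [d1 d10 Ud1] := segment_uniformly_continuous sx_cont e0.
have [d2 d20 SHd2] := saks_henstock x_int ler01 e0.
(* A number of cells beyond this sum of inverses puts the mesh below [d1], [d2] and [e] at once. *)
pose n0 := (Num.truncn (d1^-1 + d2^-1 + e^-1)).+1.
have [n n0n bn] := b_var n0 e0.
have n_gt0 : 0 < n%:R :> R by rewrite ltr0n (leq_trans _ n0n).
have n_big : d1^-1 + d2^-1 + e^-1 < n%:R.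
  by apply: lt_le_trans (truncnS_gt _) _; rewrite ler_nat.
have nV (d : R) : 0 < d -> d^-1 < n%:R -> n%:R^-1 < d.
  by move=> d0 dn; rewrite invf_plt ?posrE.
have := invr_gt0 d1; rewrite d10 => d1V.
have := invr_gt0 d2; rewrite d20 => d2V.
have := invr_gt0 e; rewrite e0 => eV.
have nd1 : n%:R^-1 < d1 by apply: nV => //; lra.
have nd2 : n%:R^-1 < d2 by apply: nV => //; lra.
have ne : n%:R^-1 < e by apply: nV => //; lra.
have nV0 : 0 < n%:R^-1 :> R by rewrite invr_gt0.
pose t i : R := i%:R / n%:R.
have tS i : t i.+1 = t i + n%:R^-1 by rewrite /t -natr1 mulrDl mul1r.
have t0 : t 0 = 0 by rewrite /t mul0r.
have tn : t n = 1 by rewrite /t divff// gt_eqF.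
have t_ge0 i : 0 <= t i by rewrite divr_ge0.
have t_le1 i : (i <= n)%N -> t i <= 1 by rewrite ler_pdivrMr// mul1r ler_nat.
pose r i := sigma (x (t i)) * (b (t i.+1) - b (t i)) - (J (t i.+1) - J (t i)).
have sum_r : \sum_(i < n) `|r i| <= 4 * e.
  by apply: SHd2 => // i iltn; rewrite tS ltrD2l nd2 ltrDl nV0.
(* Since [e <= 1], no single error exceeds 4, so the squared errors sum to at most four times the
   sum of the errors. *)
have r4 (i : 'I_n) : `|r i| <= 4.
  rewrite (@le_trans _ _ (4 * e))//; last by rewrite ler_piMr.
  apply: le_trans sum_r; rewrite (bigD1 i)//= lerDl.
  exact: sumr_ge0.
have sum_r2 : \sum_(i < n) `|r i| ^+ 2 <= 16 * e.
  apply: (@le_trans _ _ (\sum_(i < n) 4 * `|r i|)).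
    by apply: ler_sum => i _; rewrite expr2 ler_wpM2r.
  by rewrite -mulr_sumr; lra.
have tel (h : R -> R) : \sum_(i < n) (h (t i.+1) - h (t i)) = h 1 - h 0.
  rewrite -(big_mkord xpredT (fun i => h (t i.+1) - h (t i))).
  by rewrite telescope_sumr// tn t0.
have sumV : \sum_(i < n) (t i.+1 - t i) = 1 by rewrite (tel id) subr0.
have -> : lamperti (x 1) - lamperti (x 0) - c - (b 1 - b 0) =
  \sum_(i < n) (lamperti (x (t i.+1)) - lamperti (x (t i)) - c * (t i.+1 - t i)
     - (b (t i.+1) - b (t i))).
  rewrite [in RHS]sumrB [in RHS]sumrB -mulr_sumr sumV mulr1 tel.
  by have /= -> := tel (fun s => lamperti (x s)).
rewrite (le_trans (ler_norm_sum _ _ _))//.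
pose rhs i := `|c| * e / m * (t i.+1 - t i) + `|r i| / m + K / m ^+ 2 *
    (3 * ((`|c| * M) ^+ 2 * (t i.+1 - t i) ^+ 2
          + M ^+ 2 * (b (t i.+1) - b (t i)) ^+ 2 + `|r i| ^+ 2)).
apply: (@le_trans _ _ (\sum_(i < n) rhs i)).
  apply: ler_sum => i _; apply: lamperti_path_cell => //.
  - by rewrite tS ltrDl.
  - exact: t_le1.
  move=> s; rewrite tS => /andP[s1 s2].
  apply/ltW/Ud1.
  - rewrite (le_trans (t_ge0 i))//= (le_trans s2)// -tS; exact: t_le1.
  - by rewrite t_ge0 t_le1// ltnW.
  - by rewrite ger0_norm ?subr_ge0//; lra.
rewrite /rhs !big_split/= -!mulr_sumr.
rewrite sumV -mulr_suml !big_split/= -!mulr_sumr.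
(* The sum equals the mesh [1 / n]. *)
have sumV2 : \sum_(i < n) (t i.+1 - t i) ^+ 2 <= e.
  under eq_bigr do rewrite tS addrAC subrr add0r.
  rewrite sumr_const card_ord -[leLHS]mulr_natr expr2 -mulrA mulVf ?mulr1 ?ltW//.
  by rewrite gt_eqF.
have L0 : 0 <= K / m ^+ 2 by rewrite divr_ge0// exprn_ge0// ltW.
have -> : bound * e = `|c| * e / m * 1 + (4 * e) / m + K / m ^+ 2 *
    (3 * ((`|c| * M) ^+ 2 * e + M ^+ 2 * e + 16 * e)).
  by rewrite /bound; ring.
apply: lerD; first by rewrite lerD2l ler_wpM2r// invr_ge0 ltW.
rewrite ler_wpM2l// ler_wpM2l// lerD// lerD//.
  by rewrite ler_wpM2l// sqr_ge0.
by rewrite ler_wpM2l ?sqr_ge0// ltW.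
Qed.

Lemma lamperti_path : lamperti (x 1) - lamperti (x 0) = c + (b 1 - b 0).
Proof.
have approx := lamperti_path_approx.
set D := `|lamperti (x 1) - lamperti (x 0) - c - (b 1 - b 0)| in approx.
suff D0 : D <= 0.
  by move: D0; rewrite /D normr_le0 => /eqP; lra.
have bound0 : 0 <= bound.
  have := approx 1 ltr01 (lexx _); rewrite mulr1; apply: le_trans.
  exact: normr_ge0.
rewrite leNgt; apply/negP => D0.
have bD : 0 < bound + D + 1 by rewrite ltr_wpDl// addr_ge0// ltW.
(* This value of [e] is at most 1 and makes [bound * e] smaller than [D], a contradiction. *)
have e0 : 0 < D / (bound + D + 1) by rewrite divr_gt0.
have e1 : D / (bound + D + 1) <= 1 by rewrite ler_pdivrMr// mul1r; lra.
have := approx _ e0 e1; rewrite mulrA ler_pdivlMr//.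
by nra.
Qed.

End Path.
End Doss.

(** * Quadratic variation of fractional Brownian motion *)

(** Markov's inequality: if [V n] stayed above a threshold for all [n >= n0] on a set of positive
    measure, its integrals for those [n] would be bounded away from 0. Thresholds [1 / (k + 1)] keep
    the exceptional sets countable in number. *)
Lemma ae_liminf_eq0 d (T : measurableType d) (R : realType)
    (mu : {finite_measure set T -> \bar R}) (V : nat -> T -> R) :
  (forall n, measurable_fun setT (V n)) -> (forall n w, 0 <= V n w) ->
  (forall n0 e, 0 < e ->
    exists2 n, (n0 <= n)%N & (\int[mu]_w (V n w)%:E < e%:E)%E) ->
  {ae mu, forall w n0 e, 0 < e -> exists2 n, (n0 <= n)%N & V n w < e}.
Proof.
move=> mV V0 Vsmall.
have ae_nk n0 k : {ae mu, forall w, exists2 n, (n0 <= n)%N & V n w < k.+1%:R^-1}.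
  set e := k.+1%:R^-1; have e0 : 0 < e by rewrite invr_gt0.
  pose A n := [set w | (e%:E <= `|(V n w)%:E|)%E].
  have mA n : measurable (A n).
    rewrite -[A n]setTI; apply: emeasurable_fun_c_infty => //.
    by apply: measurableT_comp => //; exact/measurable_EFinP.
  pose N := \bigcap_(n in [set n | (n0 <= n)%N]) A n.
  have mN : measurable N by exact: bigcap_measurableType.
  exists N; split => //; last first.
    move=> w /= noV n /= n0n; rewrite /A /= lee_fin ger0_norm//.
    by rewrite leNgt; apply/negP => Vn; apply: noV; exists n.
  apply/eqP; rewrite -measure_le0 leNgt; apply/negP => N0.
  have Nfin : mu N \is a fin_num by exact: fin_num_measure.
  have eN0 : 0 < e * fine (mu N) by rewrite mulr_gt0// fine_gt0// N0 /= ltey_eq Nfin.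
  have [n n0n] := Vsmall n0 _ eN0; apply/negP; rewrite -leNgt EFinM fineK//.
  have mVn : measurable_fun setT (EFin \o V n) by exact/measurable_EFinP.
  have := le_integral_abse mu measurableT mVn e0.
  rewrite setTI; under eq_integral do rewrite /= ger0_norm//.
  apply: le_trans; rewrite lee_pmul2l//.
  have NA : N `<=` A n by move=> w; apply.
  apply: (@le_measure _ _ _ mu); rewrite ?inE//; exact: mA.
have : {ae mu, forall w n0 k, exists2 n, (n0 <= n)%N & V n w < k.+1%:R^-1}.
  by apply: ae_foralln => n0; apply: ae_foralln => k; exact: ae_nk.
apply: filterS => w Vw n0 e e0.
have [n n0n Vn] := Vw n0 (Num.truncn e^-1).
exists n => //; apply: (lt_trans Vn).
by rewrite invf_plt ?posrE// truncnS_gt.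
Qed.

Section FractionalBrownianMotion.
Context d (Omega : measurableType d) (R : realType) (P : probability Omega R).
Variables (H : R) (B : R -> {RV P >-> R}).
Hypothesis H_range : 2^-1 < H < 1.
Hypothesis B_fbm : fractional_brownian_motion H B.

Let H_gt0 : 0 < 2 * H.
Proof. by have /andP[? _] := H_range; lra. Qed.

(** An expectation is finite only if the positive and negative parts both have finite integrals, so
    centering already gives integrability. *)
Lemma fbm_Lfun1 t : t \in `[0, 1] -> (B t : Omega -> R) \in Lfun P 1.
Proof.
move=> t01; have [_ EB _ _] := B_fbm.
apply/Lfun1_integrable/integrableP; split; first exact/measurable_EFinP.
by rewrite integral_fin_num_abs// -expectation_def EB.
Qed.

Lemma fbm_covariance_diag t : t \in `[0, 1] ->
  covariance P (B t) (B t) = (t `^ (2 * H))%:E.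
Proof.
move=> t01; have [_ _ -> // _] := B_fbm.
by rewrite subrr normr0 powR0 ?gt_eqF// subr0; congr EFin; field.
Qed.

(** As [B t] is centered, its second moment is the covariance of [B t] with itself, a real
    number. *)
Lemma fbm_Lfun2 t : t \in `[0, 1] -> (B t : Omega -> R) \in Lfun P 2%:E.
Proof.
move=> t01; have [_ EB _ _] := B_fbm.
rewrite inE; apply/andP; split; rewrite inE/=; first exact: measurable_funPT.
rewrite /finite_norm unlock; apply: poweR_lty.
have := fbm_covariance_diag t01; rewrite covariance.unlock EB// expectation.unlock.
have -> : (\int[P]_w (((B t \- cst (fine 0)) * (B t \- cst (fine 0)))%R w)%:E =
  \int[P]_w `|(EFin \o B t) w| `^ 2)%E.
  apply: eq_integral => w _ /=.
  rewrite powR_mulrn// real_normK ?num_real//.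
  by rewrite !fctE/= subr0 expr2.
by move=> ->; exact: ltry.
Qed.

Lemma fbm_increment s t : s \in `[0, 1] -> t \in `[0, 1] ->
  (\int[P]_w ((B t w - B s w) ^+ 2)%:E = (`|t - s| `^ (2 * H))%:E)%E.
Proof.
move=> s01 t01; have [_ EB cov _] := B_fbm.
have := varianceB (fbm_Lfun2 t01) (fbm_Lfun2 s01).
rewrite /variance !fbm_covariance_diag// cov//.
rewrite covariance.unlock expectationB ?fbm_Lfun1// !EB// sube0.
rewrite expectation.unlock => E; transitivity (\int[P]_w
  (((B t \- B s \- cst (fine 0)) * (B t \- B s \- cst (fine 0)))%R w)%:E)%E.
  by apply: eq_integral => w _; rewrite !fctE/= subr0 expr2.
by rewrite E -EFinM -!EFinD; congr EFin; rewrite distrC; field.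
Qed.

(** The second moment at time 0 is a positive power of 0. *)
Lemma fbm0 : {ae P, forall w, B 0 w = 0}.
Proof.
have z01 : (0 : R) \in `[0, 1] by rewrite in_itv/= lexx ler01.
have [_ EB _ _] := B_fbm.
have := fbm_covariance_diag z01; rewrite powR0 ?gt_eqF//.
rewrite covariance.unlock EB// expectation.unlock => E.
have {}E : (\int[P]_w `|((B 0 w) ^+ 2)%:E| = 0)%E.
  rewrite -[RHS]E; apply: eq_integral => w _.
  by rewrite abse_EFin ger0_norm ?sqr_ge0// !fctE/= subr0 expr2.
have : measurable_fun setT (fun w => ((B 0 w) ^+ 2)%:E).
  by apply/measurable_EFinP; exact: measurable_funX.
move=> /(ae_eq_integral_abs P measurableT)[/(_ E)+ _].
apply: filterS => w /(_ I)/= [/eqP].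
by rewrite sqrf_eq0 => /eqP.
Qed.

Let V (n : nat) (w : Omega) : R :=
  \sum_(i < n) (B (i.+1%:R / n%:R) w - B (i%:R / n%:R) w) ^+ 2.

(** Each of the [n] increments contributes [n ^ (- 2 * H)]. *)
Lemma fbm_quadratic_variation n : (0 < n)%N ->
  (\int[P]_w (V n w)%:E = (n%:R `^ (1 - 2 * H))%:E)%E.
Proof.
move=> n0; have n0R : 0 < n%:R :> R by rewrite ltr0n.
have in01 i : (i <= n)%N -> i%:R / n%:R \in `[0, 1 : R].
  by move=> iln; rewrite in_itv/= divr_ge0//= ler_pdivrMr// mul1r ler_nat.
rewrite /V; under eq_integral do rewrite -sumEFin.
rewrite ge0_integral_sum//=; last 2 first.
- move=> i; apply/measurable_EFinP; apply: measurable_funX.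
  exact: measurable_funB.
- by move=> i w _; rewrite lee_fin sqr_ge0.
under eq_bigr => i _.
  rewrite fbm_increment ?in01// 1?ltnW//.
  rewrite -mulrBl -natrB// subSnn mul1r normfV ger0_norm//.
  over.
rewrite sumEFin; congr EFin.
rewrite big_const_ord iter_addr_0.
rewrite [RHS]powRB ?(gt_eqF n0R) ?implybT// powRr1 ?(ltW n0R)//.
rewrite -[LHS]mulr_natl; congr (_ * _).
by rewrite -[n%:R^-1]powR_inv1 ?(ltW n0R)// -powRrM mulN1r powRN.
Qed.

Lemma fbm_small_quadratic_variation n0 e : 0 < e ->
  exists2 n, (n0 < n)%N & (\int[P]_w (V n w)%:E < e%:E)%E.
Proof.
move=> e0; have h0 : 0 < 2 * H - 1 by have /andP[? _] := H_range; lra.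
(* The solution of [y ^ (2 * H - 1) = 1 / e]; any [n > y] then has [n ^ (1 - 2 * H) < e]. *)
pose y := e^-1 `^ (2 * H - 1)^-1.
exists (maxn n0 (Num.truncn y)).+1; first by rewrite ltnS leq_maxl.
set n := (_.+1); have yn : y < n%:R.
  by apply: lt_le_trans (truncnS_gt _) _; rewrite ler_nat ltnS leq_maxr.
have n_gt0 : 0 < n%:R :> R by rewrite ltr0n.
rewrite fbm_quadratic_variation// lte_fin -opprB powRN.
rewrite invf_plt ?posrE ?powR_gt0//.
have -> : e^-1 = y `^ (2 * H - 1).
  by rewrite /y -powRrM mulVf ?gt_eqF// powRr1// invr_ge0 ltW.
by rewrite gt0_ltr_powR// ?nnegrE ?powR_ge0// ltW.
Qed.

Lemma fbm_ae_quadratic_variation :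
  {ae P, forall w n0 e, 0 < e -> exists2 n, (n0 <= n)%N & V n w < e}.
Proof.
apply: ae_liminf_eq0 => [n|n w|n0 e e0].
- apply: measurable_sum => i; apply: measurable_funX.
  exact: measurable_funB.
- by apply: sumr_ge0 => i _; exact: sqr_ge0.
- by have [n /ltnW] := fbm_small_quadratic_variation n0 e0; exists n.
Qed.

End FractionalBrownianMotion.

(** * Conditional expectation *)

Section ConditionalExpectation.
Context d (Omega : measurableType d) (R : realType) (P : probability Omega R).
Implicit Types (G : set (set Omega)) (Y Z : Omega -> R).

Lemma sub_measurable_fun G Y : G `<=` measurable ->
  (forall U : set R, measurable U -> G (Y @^-1` U)) -> measurable_fun setT Y.
Proof. by move=> GM GY _ U mU; rewrite setTI; exact/GM/GY. Qed.

(** [G] is made the sigma-algebra of a measurable type, where measurability of comparisons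
    applies. *)
Lemma sigma_algebra_lt G Y1 Y2 : sigma_algebra setT G ->
  (forall U : set R, measurable U -> G (Y1 @^-1` U)) ->
  (forall U : set R, measurable U -> G (Y2 @^-1` U)) ->
  G [set w | Y1 w < Y2 w].
Proof.
move=> sG GY1 GY2.
have mY Y : (forall U : set R, measurable U -> G (Y @^-1` U)) ->
    measurable_fun (setT : set (g_sigma_algebraType G)) Y.
  by move=> GY _ U mU; rewrite setTI; apply: sub_sigma_algebra; exact: GY.
have := measurable_fun_ltr (mY _ GY1) (mY _ GY2).
move=> /(_ measurableT [set true] I); rewrite setTI.
by rewrite /measurable/= sigma_algebra_id.
Qed.

(** The event [Y1 < Y2] and its complement lie in [G], so the difference integrates to 0 over each.
    It has constant sign on each, so its absolute value integrates to 0. *)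
Lemma cond_exp_unique G Z Y1 Y2 : sigma_algebra setT G -> G `<=` measurable ->
  is_cond_exp P G Z Y1 -> is_cond_exp P G Z Y2 ->
  {ae P, forall w, Y1 w = Y2 w}.
Proof.
move=> sG GM [GY1 intY1 Y1Z] [GY2 intY2 Y2Z].
pose A := [set w | Y1 w < Y2 w].
have GA : G A by exact: sigma_algebra_lt.
have GCA : G (~` A) by case: sG => _ /(_ _ GA) + _; rewrite setTD.
have mA : measurable A by exact: GM.
have mY1 := sub_measurable_fun GM GY1; have mY2 := sub_measurable_fun GM GY2.
have int0 C Y Y' : G C ->
    P.-integrable setT (EFin \o Y) -> P.-integrable setT (EFin \o Y') ->
    (forall D, G D -> \int[P]_(w in D) (Y w)%:E = \int[P]_(w in D) (Z w)%:E)%E ->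
    (forall D, G D -> \int[P]_(w in D) (Y' w)%:E = \int[P]_(w in D) (Z w)%:E)%E ->
    (\int[P]_(w in C) ((Y w)%:E - (Y' w)%:E) = 0)%E.
  move=> GC iY iY' YZ Y'Z; have mC := GM _ GC.
  have iYC : P.-integrable C (EFin \o Y) by exact: integrableS iY.
  have iYC' : P.-integrable C (EFin \o Y') by exact: integrableS iY'.
  rewrite integralB_EFin// YZ// Y'Z// subee//.
  by rewrite -YZ//; exact: integrable_fin_num iYC.
have mD : measurable_fun setT (fun w => (Y1 w - Y2 w)%:E).
  by apply/measurable_EFinP; exact: measurable_funB.
have /(ae_eq_integral_abs P measurableT mD) :
    (\int[P]_w `|(Y1 w - Y2 w)%:E| = 0)%E.
  rewrite -(setUv A) ge0_integral_setU//=; last 3 first.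
  - exact: measurableC.
  - rewrite setUv; apply/measurable_EFinP; apply: measurableT_comp => //.
    exact: measurable_funB.
  - by apply/disj_setPS => w [].
  have <- : (\int[P]_(w in A) ((Y2 w)%:E - (Y1 w)%:E) +
      \int[P]_(w in ~` A) ((Y1 w)%:E - (Y2 w)%:E) = 0)%E.
    by rewrite int0// int0// adde0.
  congr (_ + _)%E; apply: eq_integral => w; rewrite inE /A/=.
    by move=> w12; rewrite distrC gtr0_norm// subr_gt0.
  by move=> /negP; rewrite -leNgt => w21; rewrite ger0_norm// subr_ge0.
by apply: filterS => w /(_ Logic.I) [/eqP]; rewrite subr_eq0 => /eqP.
Qed.

(** [Y] is itself a version of the conditional expectation, and the chosen version agrees with it
    almost surely. *)
Lemma cond_exp_ae G Z : sigma_algebra setT G -> G `<=` measurable ->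
  measurable_fun setT Z -> P.-integrable setT (EFin \o Z) ->
  (exists2 Y, forall U : set R, measurable U -> G (Y @^-1` U) &
    {ae P, forall w, Z w = Y w}) ->
  (measurable_fun setT (cond_exp P G Z)) /\
  {ae P, forall w, Z w = cond_exp P G Z w}.
Proof.
move=> sG GM mZ iZ [Y GY ZY]; have mY := sub_measurable_fun GM GY.
have ceY : is_cond_exp P G Z Y.
  split=> //.
    have /integrableP[_ Zoo] := iZ; apply/integrableP; split.
      exact/measurable_EFinP.
    rewrite (ae_eq_integral (fun w => `|(Z w)%:E|)%E)//.
    - by apply/measurable_EFinP; exact: measurableT_comp.
    - by apply/measurable_EFinP; exact: measurableT_comp.
    - by apply: filterS ZY => w /= -> _.
  move=> A GA; apply: ae_eq_integral.
  - exact: GM.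
  - by apply: measurable_funTS; exact/measurable_EFinP.
  - by apply: measurable_funTS; exact/measurable_EFinP.
  - by apply: filterS ZY => w -> _.
(* The version [Y] rules out the default value [cst 0]. *)
have ce : is_cond_exp P G Z (cond_exp P G Z).
  exact: (@xgetPex _ (cst 0) _ (ex_intro _ Y ceY)).
have [Gce _ _] := ce; split; first exact: sub_measurable_fun Gce.
have := cond_exp_unique sG GM ceY ce.
by apply: filterS2 ZY => w -> ->.
Qed.

End ConditionalExpectation.

(** * Lipschitz bounds, constant ratios and the inverse Lamperti transform *)

Section RealFunctions.
Context {R : realType}.
Implicit Types f g : R -> R.

Lemma bounded_fun_le T (f : T -> R) : bounded_fun f ->
  exists2 M, 0 < M & forall x, `|f x| <= M.
Proof.
move=> [M [_ fM]]; exists (`|M| + 1); first by rewrite ltr_wpDl.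
by move=> x; apply: fM => //; rewrite ltr_pwDr// ler_norm.
Qed.

Lemma derivable_lipschitz f (K : R) : (forall x, derivable f x 1) ->
  (forall x, `|derive1 f x| <= K) -> forall u v, `|f u - f v| <= K * `|u - v|.
Proof.
move=> df f'K u v.
have f_is (x : R) : is_derive x (1 : R) f (derive1 f x).
  by rewrite derive1E; apply: derivableP.
wlog uv : u v / v <= u => [hwlog|].
  have [/hwlog //|/ltW/hwlog] := leP v u.
  by rewrite distrC (distrC v).
have cf : {within `[v, u], continuous f}.
  apply: derivable_within_continuous => x _; exact: df.
have [z _ ->] := MVT_segment uv (fun x _ => f_is x) cf.
by rewrite normrM ler_wpM2r.
Qed.

(** The vanishing expression is the numerator of the derivative of [f / g]. *)
Lemma derive_ratio_cst f g : (forall x, derivable f x 1) ->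
  (forall x, derivable g x 1) -> (forall x, g x != 0) ->
  (forall x, derive1 f x * g x - f x * derive1 g x = 0) ->
  forall x, f x = f 0 / g 0 * g x.
Proof.
move=> df dg g0 fg x.
suff <- : f x / g x = f 0 / g 0 by rewrite divfK.
apply: (@is_derive_0_is_cst R (f * (fun y => (g y)^-1))) => {}x.
have f_is : is_derive x (1 : R) f (derive1 f x).
  by rewrite derive1E; apply: derivableP.
have g_is : is_derive x (1 : R) g (derive1 g x).
  by rewrite derive1E; apply: derivableP.
apply: (is_derive_eq (is_deriveM f_is (is_deriveV (g0 x) g_is))).
rewrite /GRing.scale/=.
have -> : f x * (- g x ^- 2 * derive1 g x) + (g x)^-1 * derive1 f x =
  (derive1 f x * g x - f x * derive1 g x) / g x ^+ 2 by field; exact: g0.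
by rewrite fg mul0r.
Qed.

(** All three properties follow from a slope of at least [1 / M]. Monotonicity will give Borel
    measurability of [phi], and linear growth the integrability of the solution at time 1. *)
Lemma lamperti_inverse (s : R -> R) (m M K : R) : 0 < m ->
    (forall u, m <= s u <= M) ->
    (forall u v, `|s u - s v| <= K * `|u - v|) ->
  exists phi : R -> R, [/\ cancel (lamperti s) phi, nondecreasing_fun phi &
    forall y, `|phi y - phi 0| <= M * `|y|].
Proof.
move=> m0 smM sK.
have M0 : 0 < M by have /andP[? ?] := smM 0; lra.
have [phi phiK] := choice (lamperti_surjective m0 smM sK).
have phiB y z : phi y <= phi z -> phi z - phi y <= M * (z - y).
  move=> /(lamperti_increasing m0 smM sK).
  by rewrite !phiK ler_pdivrMr// mulrC.
have phi_nd y z : y <= z -> phi y <= phi z.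
  move=> yz; rewrite leNgt; apply/negP => zy.
  have := phiB _ _ (ltW zy).
  have : M * (y - z) <= 0 by rewrite mulr_ge0_le0 ?(ltW M0)// subr_le0.
  by lra.
exists phi; split=> [u||y].
- apply/eqP; rewrite eq_le; apply/andP; split; rewrite leNgt; apply/negP => h.
    have := lamperti_increasing m0 smM sK (ltW h); rewrite phiK subrr.
    by rewrite leNgt divr_gt0// subr_gt0.
  have := lamperti_increasing m0 smM sK (ltW h); rewrite phiK subrr.
  by rewrite leNgt divr_gt0// subr_gt0.
- exact: phi_nd.
have [y0|/ltW y0] := leP 0 y.
  have := phiB _ _ (phi_nd _ _ y0); rewrite subr0 (ger0_norm y0).
  by rewrite ger0_norm// subr_ge0; exact: phi_nd.
have := phiB _ _ (phi_nd _ _ y0); rewrite sub0r distrC (ler0_norm y0).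
by rewrite ger0_norm// subr_ge0; exact: phi_nd.
Qed.

End RealFunctions.

(** * The sigma-algebra generated by the grid *)

Section Grid.
Context d (Omega : measurableType d) (R : realType) (P : probability Omega R).
Variables (B : R -> {RV P >-> R}) (n : nat).

Lemma grid_sigma_algebraP : sigma_algebra setT (grid_sigma_algebra B n).
Proof. exact: smallest_sigma_algebra. Qed.

Lemma grid_sigma_algebra_sub : grid_sigma_algebra B n `<=` measurable.
Proof.
apply: smallest_sub; first exact: sigma_algebra_measurable.
apply: (big_ind (fun A => A `<=` measurable)) => [A []|A A' Am Am' C []|i _ A].
- exact: Am.
- exact: Am'.
- by move=> [U mU <-]; exact: measurable_funPT.
Qed.

Lemma grid_sigma_algebra1 (phi : R -> R) (U : set R) : (0 < n)%N ->
  measurable_fun setT phi -> measurable U ->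
  grid_sigma_algebra B n ((phi \o B 1) @^-1` U).
Proof.
(* Index [i] stands for time [(i + 1) / n], so time 1 has index [n.-1]. *)
move=> n_gt0 mphi mU; have n1 : (n.-1 < n)%N by rewrite prednK.
apply: sub_sigma_algebra; rewrite (bigD1 (Ordinal n1))//=; left.
exists (phi @^-1` U); first by have := mphi measurableT _ mU; rewrite setTI.
by rewrite /= prednK// divff ?pnatr_eq0 -?lt0n// setTI.
Qed.

End Grid.

(** Boundedness also serves the lower estimate: [inf] of a set that is unbounded below is a default
    value. *)
Lemma bounded_fun_inf_range (R : realType) (s : R -> R) :
  bounded_fun s -> exists M, forall u, inf (range s) <= s u <= M.
Proof.
move=> /bounded_fun_le[M _ sM]; exists M => u.
rewrite (le_trans (ler_norm _) (sM u)) andbT; apply: ge_inf; last by exists u.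
exists (- M) => _ [v _ <-]; rewrite lerNl (le_trans _ (sM v))//.
by rewrite -normrN ler_norm.
Qed.

(** * Explicit form of the solution at time 1 *)

Section SolutionFormula.
Context d (Omega : measurableType d) (R : realType) (P : probability Omega R).
Variables (H x0 c m M K : R) (sigma : R -> R) (B X : R -> {RV P >-> R}).
Hypothesis H_range : 2^-1 < H < 1.
Hypothesis B_fbm : fractional_brownian_motion H B.
Hypothesis m_gt0 : 0 < m.
Hypothesis sigma_bounds : forall u, m <= sigma u <= M.
Hypothesis sigma_lipschitz : forall u v, `|sigma u - sigma v| <= K * `|u - v|.
Hypothesis X_solution : sde_solution x0 (fun u => c * sigma u) sigma B X.

Lemma lamperti_solution :
  {ae P, forall w, lamperti sigma (X 1 w) = lamperti sigma x0 + c + B 1 w}.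
Proof.
have B0 := fbm0 H_range B_fbm.
have B_var := fbm_ae_quadratic_variation H_range B_fbm.
apply: (filterS3 _ _ X_solution B0 B_var) => w [X_cont X_eq] {}B0 {}B_var.
(* The equation provides one integral for each time; choice assembles them into a function of time,
   as Saks-Henstock requires. *)
have /choice[J XJ] : forall t, exists I0, 0 <= t <= 1 ->
    is_RS_integral (fun s => sigma (X s w)) (fun s => B s w) 0 t I0 /\
    X t w = x0 + \int[lebesgue_measure]_(s in `[0, t]) (c * sigma (X s w)) + I0.
  move=> t; have [t01|_] := boolP (0 <= t <= 1); last by exists 0.
  by have [|I0 ? ?] := X_eq t; [rewrite in_itv|exists I0].
have z01 : 0 <= (0 : R) <= 1 by rewrite lexx ler01.
have XJ1 t (t01 : 0 <= t <= 1) := (XJ t t01).1.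
have XJ2 t (t01 : 0 <= t <= 1) := (XJ t t01).2.
have J0 : J 0 = 0 := RS_integral00 XJ1 ler01.
have X0 : X 0 w = x0.
  by rewrite (XJ2 _ z01) J0 set_itv1 Rintegral_set1 !addr0.
have := lamperti_path m_gt0 sigma_bounds sigma_lipschitz X_cont XJ1 XJ2 B_var.
rewrite X0 B0 subr0 => /eqP; rewrite subr_eq => /eqP ->.
by rewrite addrC addrA.
Qed.

End SolutionFormula.

(** * Vanishing of the mean square error *)

Unset Implicit Arguments.

Theorem corollary1 (R : realType) (d : measure_display)
    (Omega : measurableType d) (P : probability Omega R)
    (P_complete : measure_is_complete P)
    (H : R) (H_range : 2^-1 < H < 1)
    (B : R -> {RV P >-> R}) (B_fbm : fractional_brownian_motion H B)
    (x0 : R) (a sigma : R -> R)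
    (a_C2 : Ck 2 a) (a_derivatives : bounded_derivatives 2 a)
    (sigma_C3 : Ck 3 sigma) (sigma_derivatives : bounded_derivatives 3 sigma)
    (a_bounded : bounded_fun a) (sigma_bounded : bounded_fun sigma)
    (sigma_pos : 0 < inf (range sigma))
    (X : R -> {RV P >-> R}) (X_solution : sde_solution x0 a sigma B X)
    (coef_rel : forall x, derive1 a x * sigma x - a x * derive1 sigma x = 0)
    (n : nat) (n_pos : (0 < n)%N) :
  let Xbar := cond_exp P (grid_sigma_algebra B n) (X 1%R) in
  ('E_P[fun w => (`|X 1 w - Xbar w| ^+ 2)%R] `^ (2^-1)%R = 0)%E.
Proof.
have [M sM] := bounded_fun_inf_range sigma_bounded.
have dsigma x : derivable sigma x 1 by exact: sigma_C3.1 0%N isT x.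
have da x : derivable a x 1 by exact: a_C2.1 0%N isT x.
have [K _ sK'] := bounded_fun_le (sigma_derivatives 1%N isT).
have sK := derivable_lipschitz dsigma sK'.
have s_neq0 x : sigma x != 0.
  by have /andP[? _] := sM x; rewrite gt_eqF// (lt_le_trans sigma_pos).
set c := a 0 / sigma 0.
have aE : a = (fun u => c * sigma u).
  by apply/funext => u; exact: derive_ratio_cst.
rewrite aE in X_solution.
have [phi [phiK phi_nd phi_growth]] := lamperti_inverse sigma_pos sM sK.
(* Inverting the explicit formula gives [X 1] as [psi] of [B 1], with [psi] monotone, hence
   Borel. *)
pose psi b := phi (lamperti sigma x0 + c + b).
have X1E : {ae P, forall w, X 1 w = psi (B 1 w)}.
  have := lamperti_solution H_range B_fbm sigma_pos sM sK X_solution.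
  by apply: filterS => w XB; rewrite /psi -XB phiK.
have one01 : (1 : R) \in `[0, 1] by rewrite in_itv/= ler01 lexx.
have psi_nd : nondecreasing_fun psi.
  by move=> b b' bb'; apply: phi_nd; rewrite lerD2l.
have mpsi : measurable_fun setT psi by exact: nondecreasing_measurable.
have mX1 : measurable_fun setT (X 1) by exact: measurable_funPT.
have mpsiB : measurable_fun setT (psi \o B 1).
  by apply: measurableT_comp => //; exact: measurable_funPT.
have M0 : 0 <= M by have /andP[? ?] := sM 0; lra.
have iX1 : P.-integrable setT (EFin \o X 1).
  (* The linear growth of [phi] makes [h] dominate [psi (B 1)], and [h] is integrable because [B 1]
     is. *)
  pose C := `|phi 0| + M * `|lamperti sigma x0 + c|.
  pose h w := C + M * `|B 1 w|.
  have ih : P.-integrable setT (EFin \o h).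
    apply/Lfun1_integrable.
    rewrite (_ : h = cst C \+ (M \o* (Num.norm \o B 1))); last first.
      by apply/funext => w; rewrite /h /= mulrC.
    rewrite rpredD//=; first exact: Lfun_cst.
    by apply: Lfun_scale => //; apply: Lfun_norm; exact: fbm_Lfun1 B_fbm _ one01.
  have ipsi : P.-integrable setT (EFin \o (psi \o B 1)).
    apply: le_integrable ih => //; first exact/measurable_EFinP.
    move=> w _ /=; rewrite lee_fin [leRHS]ger0_norm; last first.
      by rewrite /h /C !addr_ge0// mulr_ge0.
    rewrite /psi /h /C; move: (B 1 w) (lamperti sigma x0 + c) => b y.
    have h1 : `|phi (y + b)| <= `|phi (y + b) - phi 0| + `|phi 0|.
      by rewrite -{1}(subrK (phi 0) (phi (y + b))) ler_normD.
    have h2 : M * `|y + b| <= M * `|y| + M * `|b|.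
      by rewrite -mulrDr ler_wpM2l// ler_normD.
    by have h3 := phi_growth (y + b); lra.
  have /integrableP[_ psioo] := ipsi; apply/integrableP; split.
    exact/measurable_EFinP.
  rewrite (ae_eq_integral (fun w => `|((psi \o B 1) w)%:E|)%E)//.
  - by apply/measurable_EFinP; exact: measurableT_comp.
  - by apply/measurable_EFinP; exact: measurableT_comp.
  - by apply: filterS X1E => w /= -> _.
move=> Xbar.
(* Time 1 is a grid point, so [psi \o B 1] is measurable for the grid sigma-algebra and conditioning
   leaves [X 1] almost surely unchanged. *)
have [mXbar X1Xbar] : measurable_fun setT Xbar /\ {ae P, forall w, X 1 w = Xbar w}.
  apply: cond_exp_ae => //.
  - exact: grid_sigma_algebraP.
  - exact: grid_sigma_algebra_sub.
  exists (psi \o B 1) => // U mU; exact: grid_sigma_algebra1.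
rewrite expectation.unlock (ae_eq_integral (cst 0%E)) ?integral0 ?poweR0r//.
- apply/measurable_EFinP; apply: measurable_funX; apply: measurableT_comp => //.
  exact: measurable_funB.
- by apply: filterS X1Xbar => w -> _; rewrite subrr normr0 expr0n.
Qed.
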